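(* Let $G = (V,E)$ be a finite, simple, undirected graph with a dominating clique $K$ of order $|K| \geq 4$. If, for every vertex $v \in V \setminus K$, $d(v) \leq \min_{u \in K} d(u)$, then $G$ is antimagic.
   Context: All graphs are finite, simple and undirected. For a graph $G=(V,E)$, write $m = |E|$, and let $d(v)$ denote the degree of $v$ in $G$ (the number of neighbors of $v$). A clique in $G$ is a set of vertices inducing a complete subgraph of $G$. A clique $K \subseteq V$ is a dominating clique if every vertex $v \in V \setminus K$ has a neighbor in $K$. The same symbol $K$ denotes the clique and its vertex set. Given a labelling $f : E \to \{1,2,\ldots,m\}$, for each vertex $u \in V$ let $\sigma(u) = \sum_{v \in V,\ uv \in E} f(uv)$ be the sum of the labels of the edges incident to $u$. The graph $G$ is antimagic if there exists a bijective labelling $f : E \to \{1,2,\ldots,m\}$ such that the values $\sigma(u)$, $u \in V$, are pairwise distinct. *)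

(* Defs.v *)
From mathcomp Require Import all_boot.

Set Implicit Arguments.
Unset Strict Implicit.
Unset Printing Implicit Defensive.

(* A finite simple undirected graph is a symmetric irreflexive relation
   [e : rel T] on a finite type [T] of vertices. *)

Definition edges (T : finType) (e : rel T) : {set {set T}} :=
  [set A : {set T} | [exists x, exists y, e x y && (A == [set x; y])]].

Definition deg (T : finType) (e : rel T) (v : T) : nat := #|[set u | e v u]|.

Definition clique (T : finType) (e : rel T) (K : {set T}) : Prop :=
  {in K &, forall x y, x != y -> e x y}.

Definition dominating_clique (T : finType) (e : rel T) (K : {set T}) : Prop :=
  clique e K /\ (forall v, v \notin K -> exists2 u, u \in K & e v u).

(* The index [#|T|] exceeds every degree of a simple graph, so it does not
   contribute to the minimum when [K] is nonempty. *)
Definition min_deg (T : finType) (e : rel T) (K : {set T}) : nat :=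
  \big[minn/#|T|]_(u in K) deg e u.

(* A labelling of the edges is a function on all vertex sets; only its values
   on [edges e] matter. *)
Definition bijective_labelling (T : finType) (e : rel T)
    (f : {set T} -> nat) : Prop :=
  [/\ {in edges e, forall a, 1 <= f a <= #|edges e|},
      {in edges e &, injective f} &
      forall k, 1 <= k <= #|edges e| -> exists2 a, a \in edges e & f a = k].

Definition vertex_sum (T : finType) (e : rel T) (f : {set T} -> nat) (u : T) :
    nat :=
  \sum_(v | e u v) f [set u; v].

Definition antimagic (T : finType) (e : rel T) : Prop :=
  exists2 f : {set T} -> nat,
    bijective_labelling e f & injective (vertex_sum e f).

(* Main.v *)
(** Use the labels in increasing order on: the edges avoiding [K]; the edges
    between [K] and its complement, keeping for the end one edge [w (c w)] for
    each [w] outside [K]; those reserved edges, by increasing partial sum of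
    [w]; the edges inside [K], lexicographically for an order of [K] in which
    the partial sums increase.  Then the sums increase along the chosen order
    outside [K], and also along the one inside [K].  Finally, if [w] is outside
    and [u] inside [K], drop the edge [uw] from both sums if it exists.  At
    most [#|K| - 1] edges from [w] to [K] remain, which the larger labels of
    the [#|K| - 1] edges from [u] inside [K] dominate; the other edges of [w]
    avoid [K], so any remaining edges of [u] dominate them, and [u] has enough
    of these because [deg w <= deg u]. *)

Require Import Defs.
From mathcomp Require Import all_boot zify.

Set Implicit Arguments.
Unset Strict Implicit.
Unset Printing Implicit Defensive.

(** * Indices, minima, and edges as two-element sets *)

Lemma index_map_in (T1 T2 : eqType) (f : T1 -> T2) (s : seq T1) (x : T1) :
  {in s &, injective f} -> x \in s -> index (f x) (map f s) = index x s.
Proof.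
elim: s => // y s IH f_inj; rewrite inE /=.
have [-> | neq_yx] := eqVneq y x; first by rewrite eqxx.
move=> /= xs.
have -> : (f y == f x) = false.
  by apply: contra_neqF neq_yx => /eqP/f_inj-> //; rewrite inE ?eqxx ?xs ?orbT.
by rewrite IH // => a b sa sb; apply: f_inj; rewrite inE ?sa ?sb orbT.
Qed.

Lemma bigminn_leq (I : eqType) (r : seq I) (P : pred I) (F : I -> nat) n i :
  i \in r -> P i -> \big[minn/n]_(j <- r | P j) F j <= F i.
Proof.
elim: r => // j r IH; rewrite inE big_cons => /orP[/eqP <- -> | ir Pi].
  by rewrite geq_minl.
by case: ifP => _; rewrite ?geq_min IH ?orbT.
Qed.

Lemma min_deg_leq (T : finType) (e : rel T) (K : {set T}) u :
  u \in K -> min_deg e K <= deg e u.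
Proof. by apply: bigminn_leq; rewrite mem_index_enum. Qed.

Lemma set2_injr (T : finType) (x y z : T) : [set x; y] = [set x; z] -> y = z.
Proof.
move=> /setP eq_xyz; move: (eq_xyz y) (eq_xyz z); rewrite !inE !eqxx !orbT.
by move=> /esym/orP[]/eqP // -> /orP[]/eqP.
Qed.

Lemma mem_edges (T : finType) (e : rel T) x y :
  symmetric e -> ([set x; y] \in edges e) = e x y.
Proof.
move=> e_sym; apply/idP/idP; last first.
  by move=> exy; rewrite inE; apply/existsP; exists x; apply/existsP; exists y;
     rewrite exy eqxx.
rewrite inE => /existsP[a /existsP[b /andP[eab /eqP eq_xy]]].
have : x \in [set a; b] by rewrite -eq_xy !inE eqxx.
rewrite !inE => /orP[]/eqP eq_x; subst x.
  by rewrite (set2_injr eq_xy).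
by move: eq_xy; rewrite (setUC [set a]) => /set2_injr ->; rewrite e_sym.
Qed.

Lemma edgesP (T : finType) (e : rel T) (a : {set T}) :
  reflect (exists x y, e x y /\ a = [set x; y]) (a \in edges e).
Proof.
rewrite inE; apply: (iffP existsP) => [[x /existsP[y /andP[exy /eqP ->]]]|].
  by exists x, y.
by case=> x [y [exy ->]]; exists x; apply/existsP; exists y; rewrite exy eqxx.
Qed.

(** Positions start at 0 and labels at 1, hence the successor; the edge with a given label is read
    off at the corresponding position. *)
Lemma bijective_labelling_index (T : finType) (e : rel T) (s : seq {set T}) :
  uniq s -> s =i edges e -> bijective_labelling e (fun a => (index a s).+1).
Proof.
move=> s_uniq s_edges.
have size_s : #|edges e| = size s by rewrite -(card_uniqP s_uniq); apply: eq_card.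
split=> [a | a b | k].
- by rewrite -s_edges size_s -index_mem.
- by rewrite -!s_edges => sa sb [] /(index_inj a sa sb).
- case: k => // k; rewrite size_s /= => lt_ks.
  exists (nth set0 s k); first by rewrite -s_edges mem_nth.
  by rewrite index_uniq.
Qed.

(** * The edges of a clique in lexicographic order *)

Fixpoint pairs (T : finType) (s : seq T) : seq {set T} :=
  if s is x :: r then [seq [set x; y] | y <- r] ++ pairs r else [::].

Lemma mem_pairs (T : finType) (s : seq T) x y :
  x \in s -> y \in s -> x != y -> [set x; y] \in pairs s.
Proof.
elim: s => // a s IH; rewrite !inE /= mem_cat.
case: (eqVneq x a) => [-> | neq_xa] /=.
  move=> _; rewrite eq_sym; case: eqVneq => //= _ ys _.
  by apply/orP; left; apply: map_f.
case: (eqVneq y a) => [-> | neq_ya] /= xs ys neq_xy.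
  by rewrite setUC; apply/orP; left; apply: map_f.
by rewrite IH ?orbT.
Qed.

Lemma pairs_mem (T : finType) (s : seq T) (a : {set T}) :
  uniq s -> a \in pairs s ->
  exists x y, [/\ x \in s, y \in s, x != y & a = [set x; y]].
Proof.
elim: s => // z s IH /= /andP[zs s_uniq]; rewrite mem_cat => /orP[/mapP[y ys ->]|].
  exists z, y; split; rewrite ?inE ?eqxx ?ys ?orbT //.
  by apply: contraNneq zs => ->.
move=> /(IH s_uniq)[x [y [xs ys neq_xy ->]]].
by exists x, y; rewrite !inE xs ys !orbT.
Qed.

Lemma notin_pairs (T : finType) (s : seq T) x y :
  uniq s -> x \notin s -> [set x; y] \notin pairs s.
Proof.
move=> s_uniq xs; apply/negP => /(pairs_mem s_uniq)[a [b [sa sb _]]].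
move=> /setP/(_ x); rewrite !inE eqxx => /esym/orP[]/eqP eq_x;
  by rewrite eq_x ?sa ?sb in xs.
Qed.

Lemma pairs_uniq (T : finType) (s : seq T) : uniq s -> uniq (pairs s).
Proof.
elim: s => // x s IH /= /andP[xs s_uniq].
rewrite cat_uniq IH // map_inj_uniq ?s_uniq; last exact: set2_injr.
rewrite andbT; apply/hasPn => a; apply: contraL => /mapP[y _ ->].
exact: notin_pairs.
Qed.

(* [pairs s] lists the edges lexicographically, so moving one endpoint forward
   moves the edge forward. *)
Lemma index_pairs_lt (T : finType) (s : seq T) x y z :
  uniq s -> x \in s -> y \in s -> z \in s -> z != x -> z != y ->
  index x s < index y s ->
  index [set x; z] (pairs s) < index [set y; z] (pairs s).
Proof.
elim: s => // a s IH /= /andP[sa s_uniq].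
have head_mem v : v \in s -> [set a; v] \in [seq [set a; t] | t <- s].
  exact: map_f.
have index_head v :
    index [set a; v] [seq [set a; t] | t <- s] = index v s.
  by apply: index_map => u t; apply: set2_injr.
have tail_notin u v : u \in s -> v \in s ->
    [set u; v] \notin [seq [set a; t] | t <- s].
  move=> us vs; apply/mapP => -[t _ /setP/(_ a)].
  by rewrite !inE eqxx /= => /orP[]/eqP eq_a; rewrite eq_a ?us ?vs in sa.
rewrite !inE !(eq_sym _ a) !index_cat.
(* The head is not [y], whose index is positive. If it is [x], then [[set x; z]] lies in the first
   block and [[set y; z]] in the tail; if it is [z], both lie in the first block, ordered as [x] and
   [y]; otherwise both lie in the tail. *)
case: (eqVneq a y) => [<- // | _] /=.
case: (eqVneq a x) => [<- | _] /= xs ys.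
  case: (eqVneq a z) => [<- // | _] /= zs.
  move=> _ neq_zy _; rewrite head_mem // (negPf (tail_notin _ _ _ _)) //.
  by rewrite ltn_addr // index_mem head_mem.
case: (eqVneq a z) => [<- | _] /= zs neq_zx neq_zy; rewrite ltnS => lt_xy.
  by rewrite !(setUC _ [set a]) !head_mem // !index_head.
rewrite !(negPf (tail_notin _ _ _ _)) // ltn_add2l; exact: IH.
Qed.

(** * Comparison of vertex sums *)

(** The conditional term allows removing an edge that may or may not exist. *)
Lemma sumnD1 (T : finType) (P : pred T) (F : T -> nat) z :
  \sum_(v | P v) F v =
    (if P z then F z else 0) + \sum_(v | P v && (v != z)) F v.
Proof.
case: ifP => Pz; first by rewrite (bigD1 z).
rewrite add0n; apply: eq_bigl => v.
by case: eqVneq => [->|_]; rewrite ?Pz // andbT.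
Qed.

Lemma leq_sum_const (T : finType) (P : pred T) (F : T -> nat) n :
  (forall v, P v -> F v <= n) -> \sum_(v | P v) F v <= (\sum_(v | P v) 1) * n.
Proof.
by move=> F_le; rewrite big_distrl /=; apply: leq_sum => v /F_le; rewrite mul1n.
Qed.

Lemma geq_sum_const (T : finType) (P : pred T) (F : T -> nat) n :
  (forall v, P v -> n <= F v) -> (\sum_(v | P v) 1) * n <= \sum_(v | P v) F v.
Proof.
by move=> F_ge; rewrite big_distrl /=; apply: leq_sum => v /F_ge; rewrite mul1n.
Qed.

(** With [uw] removed, let [w] keep [A] edges avoiding [K] and [B] into [K], and let [u] keep [D]
    edges leaving [K] and [#|K|.-1] inside. Since [A + B <= D + #|K|.-1] and [B <= #|K|.-1], the
    number [A * N + B * M = (A + B) * N + B * (M - N)] is at most [D * N + #|K|.-1 * M]; as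
    [#|K|.-1 > 0], this is less than the lower bound for [u]. *)
Lemma vertex_sum_outside_lt (T : finType) (e : rel T) (K : {set T})
    (f : {set T} -> nat) (N M : nat) u w :
  symmetric e -> irreflexive e -> clique e K -> 2 <= #|K| -> N <= M ->
  {in ~: K &, forall v v', e v v' -> f [set v; v'] <= N} ->
  {in K & ~: K, forall v v', e v v' -> N < f [set v; v'] <= M} ->
  {in K &, forall v v', e v v' -> M < f [set v; v']} ->
  u \in K -> w \notin K -> deg e w <= deg e u ->
  vertex_sum e f w < vertex_sum e f u.
Proof.
move=> e_sym e_irr K_cl K_ge2 le_NM f_out f_mid f_in uK wK.
have deg_sum v : deg e v = \sum_(v' | e v v') 1.
  by rewrite sum1dep_card.
rewrite !deg_sum /vertex_sum.
(* For arbitrary [F], the splitting serves both the vertex sum and, with [F] constantly 1, the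
   degree. *)
have split_w F : \sum_(v | e w v) F v = (if e w u then F u else 0) +
    \sum_(v | e w v && (v \in K) && (v != u)) F v +
    \sum_(v | e w v && (v \notin K)) F v.
  by rewrite (bigID (mem K)) /= [X in X + _](@sumnD1 _ _ _ u) uK andbT.
have split_u F : \sum_(v | e u v) F v = (if e u w then F w else 0) +
    \sum_(v | e u v && (v \notin K) && (v != w)) F v +
    \sum_(v | e u v && (v \in K)) F v.
  by rewrite (bigID (mem K)) /= [X in _ + X](@sumnD1 _ _ _ w) wK andbT addnC.
rewrite !{}split_w !{}split_u (setUC [set w]) (e_sym w u).
have wC : w \in ~: K by rewrite inE.
have le_Wout : \sum_(v | e w v && (v \notin K)) f [set w; v] <=
    (\sum_(v | e w v && (v \notin K)) 1) * N.
  by apply: leq_sum_const => v /andP[ewv vK]; apply: f_out; rewrite ?inE.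
have le_Win : \sum_(v | e w v && (v \in K) && (v != u)) f [set w; v] <=
    (\sum_(v | e w v && (v \in K) && (v != u)) 1) * M.
  apply: leq_sum_const => v /andP[/andP[ewv vK] _]; rewrite setUC.
  by move: (f_mid v w vK wC); rewrite e_sym => /(_ ewv)/andP[].
have ge_Uout : (\sum_(v | e u v && (v \notin K) && (v != w)) 1) * N.+1 <=
    \sum_(v | e u v && (v \notin K) && (v != w)) f [set u; v].
  apply: geq_sum_const => v /andP[/andP[euv vK] _].
  by move: (f_mid u v uK); rewrite inE => /(_ vK euv)/andP[].
have ge_Uin : (\sum_(v | e u v && (v \in K)) 1) * M.+1 <=
    \sum_(v | e u v && (v \in K)) f [set u; v].
  by apply: geq_sum_const => v /andP[euv vK]; apply: f_in.
have eq_in : \sum_(v | e u v && (v \in K)) 1 = #|K|.-1.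
  rewrite (cardsD1 u) uK /= sum1dep_card; apply: eq_card => v; rewrite !inE.
  have [-> | neq_vu] := eqVneq v u; first by rewrite e_irr.
  by case vK: (v \in K); rewrite ?andbF // K_cl // eq_sym.
(* Even if [w] is adjacent to all of [K], leaving out [u] lowers the count to [#|K|.-1]. *)
have le_in : \sum_(v | e w v && (v \in K) && (v != u)) 1 <= #|K|.-1.
  rewrite (cardsD1 u) uK /= sum1dep_card; apply: subset_leq_card.
  by apply/subsetP => v; rewrite !inE => /andP[/andP[_ ->] ->].
move: eq_in le_in le_Wout le_Win ge_Uout ge_Uin.
move: (\sum_(v | e w v && (v \in K) && (v != u)) 1) => B.
move: (\sum_(v | e w v && (v \notin K)) 1) => A.
move: (\sum_(v | e u v && (v \in K)) 1) => C.
move: (\sum_(v | e u v && (v \notin K) && (v != w)) 1) => D.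
set x := (if e u w then f _ else 0).
set y := (if e u w then 1 else 0).
move=> -> le_B le_Wout le_Win ge_Uout ge_Uin le_deg.
have : x + B * M + A * N < x + D * N.+1 + #|K|.-1 * M.+1.
  have {}le_deg : A + B <= D + #|K|.-1 by lia.
  have [P] : exists P, M = N + P by exists (M - N); lia.
  by move=> ->; nia.
by lia.
Qed.

(* The edge [xy] is common to both sums; a third vertex of [K] makes the
   inequality strict. *)
Lemma vertex_sum_clique_lt (T : finType) (e : rel T) (K : {set T})
    (f : {set T} -> nat) x y :
  irreflexive e -> clique e K -> 3 <= #|K| ->
  x \in K -> y \in K -> x != y ->
  \sum_(v | e x v && (v \notin K)) f [set x; v] <=
    \sum_(v | e y v && (v \notin K)) f [set y; v] ->
  {in K, forall z, z != x -> z != y -> f [set x; z] < f [set y; z]} ->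
  vertex_sum e f x < vertex_sum e f y.
Proof.
move=> e_irr K_cl K_ge3 xK yK neq_xy le_out lt_in.
have nbr_in u : u \in K -> forall v, e u v && (v \in K) = (v \in K) && (v != u).
  move=> uK v; have [-> | neq_vu] := eqVneq v u; first by rewrite e_irr andbF.
  by case vK: (v \in K); rewrite ?andbF // K_cl // eq_sym.
rewrite /vertex_sum !(bigID (mem K) (e _)) /= -addSn leq_add //.
rewrite (eq_bigl _ _ (nbr_in x xK)) (eq_bigl _ _ (nbr_in y yK)).
rewrite [ltnLHS](@sumnD1 _ _ _ y) [ltnRHS](@sumnD1 _ _ _ x).
rewrite xK yK neq_xy (eq_sym y) neq_xy /= (setUC [set y]) ltn_add2l.
have [z zK] : exists z, z \in K :\ x :\ y.
  apply/set0Pn; rewrite -card_gt0; move: K_ge3.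
  by rewrite (cardsD1 x) xK (cardsD1 y) !inE yK eq_sym neq_xy.
move: zK; rewrite !inE => /andP[neq_zy /andP[neq_zx zK]].
rewrite [ltnRHS](eq_bigl (fun v => (v \in K) && (v != x) && (v != y))); last first.
  by move=> v; rewrite andbAC.
rewrite (bigD1 z) ?zK ?neq_zx //= [ltnRHS](bigD1 z) ?zK ?neq_zx //=.
rewrite -addSn leq_add ?lt_in // leq_sum // => v.
by move=> /andP[/andP[/andP[vK neq_vx] neq_vy] _]; apply/ltnW/lt_in.
Qed.

Lemma leq_index_sort (T : eqType) (q : T -> nat) (s : seq T) x y :
  let r := sort (fun a b => q a <= q b) s in
  x \in r -> y \in r -> index x r < index y r -> q x <= q y.
Proof.
move=> r xr yr /ltnW.
apply: (sorted_leq_index (leT := fun a b => q a <= q b)) xr yr => //.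
- by move=> a b c; apply: leq_trans.
- by apply: sort_sorted => a b; apply: leq_total.
Qed.

Lemma injective_index_lt (T : finType) (g : T -> nat) (s : seq T) :
  {in s &, forall x y, index x s < index y s -> g x < g y} ->
  {in s &, injective g}.
Proof.
move=> g_lt x y xs ys eq_g; apply: (index_inj x xs ys).
by apply/eqP; case: ltngtP => // /g_lt; rewrite eq_g ltnn => ->.
Qed.

Theorem theorem4 (T : finType) (e : rel T)
    (e_sym : symmetric e) (e_irr : irreflexive e)
    (K : {set T}) (K_dom : dominating_clique e K) (K_ge4 : 4 <= #|K|)
    (K_deg : forall v, v \notin K -> deg e v <= min_deg e K) :
  antimagic e.
Proof.
case: K_dom => K_cl K_dom.

(* The order of the edges *)
pose c w := odflt w [pick u in K | e w u].
have cP w : w \notin K -> c w \in K /\ e w (c w).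
  move=> wK; rewrite /c; case: pickP => [u /andP[] // | no_u].
  by have [u uK ewu] := K_dom w wK; move: (no_u u); rewrite uK ewu.
pose C := [set [set w; c w] | w in ~: K].
pose s1 := enum [set a in edges e | [disjoint a & K]].
pose s2 := enum [set a in edges e |
  [&& ~~ [disjoint a & K], ~~ (a \subset K) & a \notin C]].
(* All edges at [w] except the reserved one lie in [s1 ++ s2], and appending later blocks keeps
   their indices, so [p w] is already a sum of final labels. *)
pose p w := \sum_(v | e w v && (v != c w)) (index [set w; v] (s1 ++ s2)).+1.
pose sw := sort (fun x y => p x <= p y) (enum (~: K)).
pose s3 := [seq [set w; c w] | w <- sw].
pose s123 := (s1 ++ s2) ++ s3.
(* Likewise final: every edge leaving [K], reserved or not, lies in [s123]. *)
pose q u := \sum_(v | e u v && (v \notin K)) (index [set u; v] s123).+1.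
pose sk := sort (fun x y => q x <= q y) (enum K).
pose s := s123 ++ pairs sk.
have sw_uniq : uniq sw by rewrite sort_uniq enum_uniq.
have sk_uniq : uniq sk by rewrite sort_uniq enum_uniq.
have mem_sw w : (w \in sw) = (w \notin K) by rewrite mem_sort mem_enum inE.
have mem_sk u : (u \in sk) = (u \in K) by rewrite mem_sort mem_enum.
have disj2 x y : [disjoint [set x; y] & K] = (x \notin K) && (y \notin K).
  by rewrite disjoints_subset subUset !sub1set !inE.
have sub2 x y : ([set x; y] \subset K) = (x \in K) && (y \in K).
  by rewrite subUset !sub1set.
(* A reserved edge has a single endpoint outside [K], which can thus be recovered from it. *)
have c_inj : {in sw &, injective (fun w => [set w; c w])}.
  move=> x y; rewrite !mem_sw => xK yK /setP/(_ x); rewrite !inE eqxx /=.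
  move=> /esym/orP[]/eqP // eq_x; have [] := cP y yK.
  by rewrite -eq_x (negPf xK).
have s1P a : a \in s1 -> a \in edges e /\ [disjoint a & K].
  by rewrite mem_enum inE => /andP[].
have s2P a : a \in s2 ->
    [/\ a \in edges e, ~~ [disjoint a & K], ~~ (a \subset K) & a \notin C].
  by rewrite mem_enum inE => /andP[-> /and3P[-> -> ->]].
have s3P a : a \in s3 -> exists2 w, w \notin K & a = [set w; c w].
  by case/mapP => w; rewrite mem_sw => wK ->; exists w.
have s3C a : (a \in s3) = (a \in C).
  apply/mapP/imsetP => -[w wP ->]; exists w => //; move: wP;
    by rewrite mem_sw ?inE.
have s4P a : a \in pairs sk ->
    exists x y, [/\ x \in K, y \in K, x != y & a = [set x; y]].
  by case/(pairs_mem sk_uniq) => x [y []]; rewrite !mem_sk; exists x, y.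

(* The list [s] enumerates the edges without repetition *)
have s_uniq : uniq s.
  rewrite /s cat_uniq pairs_uniq // /s123 cat_uniq map_inj_in_uniq // sw_uniq.
  rewrite cat_uniq !enum_uniq !andbT /=.
  apply/andP; split; first (apply/andP; split).
  - by apply/hasPn => a /s2P[_ + _ _]; apply: contra => /s1P[].
  - apply/hasPn => a as3; rewrite /= mem_cat.
    apply/negP => /orP[/s1P[_] | /s2P[_ _ _]]; last by rewrite -s3C as3.
    case/s3P: as3 => w wK ->; rewrite disj2; case: (cP w wK) => -> _.
    by rewrite andbF.
  apply/hasPn => a /s4P[x [y [xK yK _ ->]]].
  rewrite /= !mem_cat; apply/negP => /orP[/orP[/s1P[_]|/s2P[_ _]]|/s3P[w wK]].
  - by rewrite disj2 xK.
  - by rewrite sub2 xK yK.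
  move=> /setP/(_ w); rewrite !inE eqxx /= => /orP[]/eqP eq_w;
    by rewrite eq_w ?xK ?yK in wK.
have s1_edge x y : x \notin K -> y \notin K -> e x y -> [set x; y] \in s1.
  by move=> xK yK exy; rewrite mem_enum inE mem_edges // exy disj2 xK yK.
have s2_edge x y : x \in K -> y \notin K -> e x y -> x != c y ->
    [set x; y] \in s2.
  move=> xK yK exy neq_xc; rewrite mem_enum inE mem_edges // exy disj2 sub2.
  rewrite xK (negPf yK) /=; apply/imsetP => -[w]; rewrite inE => wK.
  have [cK _] := cP w wK; rewrite setUC => eq_yx.
  (* The only endpoint outside [K] is [y] on one side and [w] on the other; then [x = c y], which
     was excluded. *)
  have eq_yw : y = w.
    move/setP/(_ y): eq_yx; rewrite !inE eqxx => /esym/orP[]/eqP // eq_y.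
    by rewrite eq_y cK in yK.
  by move: eq_yx neq_xc; rewrite eq_yw => /set2_injr ->; rewrite eqxx.
have s3_edge w : w \notin K -> [set w; c w] \in s3.
  by move=> wK; apply/mapP; exists w; rewrite ?mem_sw.
have s4_edge x y : x \in K -> y \in K -> x != y -> [set x; y] \in pairs sk.
  by move=> xK yK; apply: mem_pairs; rewrite mem_sk.
have mid_edge x y : x \in K -> y \notin K -> e x y -> 
    ([set x; y] \in s2) || ([set x; y] \in s3).
  move=> xK yK exy; have [-> | neq_xc] := eqVneq x (c y).
    by rewrite setUC s3_edge ?orbT.
  by rewrite s2_edge.
have s_edges : s =i edges e.
  move=> a; apply/idP/edgesP => [|[x [y [exy ->]]]].
    rewrite !mem_cat => /orP[/orP[/orP[/s1P[]|/s2P[]]|/s3P[w wK ->]]|].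
    - by move/edgesP.
    - by move/edgesP.
    - by exists w, (c w); case: (cP w wK).
    by case/s4P => x [y [xK yK neq_xy ->]]; exists x, y; rewrite K_cl.
  have neq_xy : x != y by apply: contraTneq exy => ->; rewrite e_irr.
  rewrite !mem_cat; case xK: (x \in K); case yK: (y \in K).
  - by rewrite s4_edge ?orbT.
  - by rewrite -(orbA (_ \in s1)) mid_edge ?yK ?orbT.
  - by rewrite setUC -(orbA (_ \in s1)) mid_edge ?xK ?orbT // e_sym.
  - by rewrite s1_edge ?xK ?yK.

(* Labels block by block *)
pose f a := (index a s).+1.
have s123_mid x y : x \in K -> y \notin K -> e x y -> [set x; y] \in s123.
  by move=> xK yK exy; rewrite !mem_cat -orbA mid_edge ?orbT.
have f_s123 a : a \in s123 -> f a = (index a s123).+1.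
  by move=> as123; rewrite /f index_cat as123.
have f_s12 a : a \in s1 ++ s2 -> f a = (index a (s1 ++ s2)).+1.
  by move=> as12; rewrite f_s123 ?index_cat ?as12 // mem_cat as12.
have f_s3 w : w \notin K -> f [set w; c w] = (size (s1 ++ s2) + index w sw).+1.
  move=> wK; have as3 := s3_edge w wK.
  rewrite f_s123; last by rewrite mem_cat as3 orbT.
  rewrite index_cat ifN; first by rewrite (index_map_in c_inj) ?mem_sw.
  move: s_uniq; rewrite cat_uniq => /andP[+ _]; rewrite cat_uniq => /and3P[_ + _].
  by move/hasPn/(_ _ as3).
have f_s4 a : a \in pairs sk -> f a = (size s123 + index a (pairs sk)).+1.
  move=> as4; rewrite /f index_cat ifN //.
  by move: s_uniq; rewrite cat_uniq => /and3P[_ /hasPn/(_ _ as4) + _].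
(* The thresholds [size s1] and [size s123] act as [N] and [M] in [vertex_sum_outside_lt]. *)
have f_out : {in ~: K &, forall v v', e v v' -> f [set v; v'] <= size s1}.
  move=> x y; rewrite !inE => xK yK exy; have as1 := s1_edge x y xK yK exy.
  by rewrite f_s12 ?mem_cat ?as1 // index_cat as1 index_mem.
have f_mid : {in K & ~: K, forall v v', e v v' ->
    size s1 < f [set v; v'] <= size s123}.
  move=> x y; rewrite inE => xK yK exy; have as123 := s123_mid x y xK yK exy.
  rewrite f_s123 // index_mem as123 andbT /s123 -catA index_cat ifN.
    by rewrite ltnS leq_addr.
  by apply/negP => /s1P[_]; rewrite disj2 xK.
have f_in : {in K &, forall v v', e v v' -> size s123 < f [set v; v']}.
  move=> x y xK yK exy; rewrite f_s4 ?ltnS ?leq_addr // s4_edge //.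
  by apply: contraTneq exy => ->; rewrite e_irr.

(* Distinctness of the vertex sums *)
have lt_out_in u w : u \in K -> w \notin K -> vertex_sum e f w < vertex_sum e f u.
  move=> uK wK; apply: (vertex_sum_outside_lt e_sym e_irr K_cl _ _ f_out f_mid f_in) => //.
  - by apply: leq_trans K_ge4.
  - by rewrite !size_cat -addnA leq_addr.
  - exact: leq_trans (K_deg w wK) (min_deg_leq _ uK).
have inj_out : {in sw &, injective (vertex_sum e f)}.
  have sumE w : w \notin K -> vertex_sum e f w = p w + f [set w; c w].
    move=> wK; have [cK ewc] := cP w wK.
    rewrite /vertex_sum (bigD1 (c w)) //= addnC; congr (_ + _).
    apply: eq_bigr => v /andP[ewv neq_vc]; apply: f_s12; rewrite mem_cat.
    case vK: (v \in K); last by rewrite s1_edge ?vK.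
    by rewrite setUC s2_edge ?orbT // e_sym.
  apply: injective_index_lt => x y xs ys lt_xy.
  have le_p := leq_index_sort xs ys lt_xy.
  move: xs ys; rewrite !mem_sw => xK yK.
  (* [p] increases weakly along [sw] and the reserved labels strictly, so ties in [p] are broken. *)
  by rewrite !sumE // !f_s3 // -addnS leq_add // !ltnS ltn_add2l.
have inj_in : {in sk &, injective (vertex_sum e f)}.
  have sumE u : u \in K ->
      \sum_(v | e u v && (v \notin K)) f [set u; v] = q u.
    by move=> uK; apply: eq_bigr => v /andP[euv vK]; rewrite f_s123 ?s123_mid.
  apply: injective_index_lt => x y xs ys lt_xy.
  have le_q := leq_index_sort xs ys lt_xy.
  have neq_xy : x != y by apply: contraTneq lt_xy => ->; rewrite ltnn.
  move: (xs) (ys); rewrite !mem_sk => xK yK.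
  apply: (@vertex_sum_clique_lt _ e K f x y) => //; rewrite ?sumE //.
    exact: leq_trans K_ge4.
  (* The labels leaving [K] are compared by [q]; inside [K], the lexicographic order makes
     [[set x; z]] precede [[set y; z]]. *)
  move=> z zK neq_zx neq_zy; rewrite !f_s4 ?s4_edge // 1?eq_sym //.
  by rewrite ltnS ltn_add2l index_pairs_lt ?mem_sk.
exists f; first exact: bijective_labelling_index.
move=> x y eq_xy; case xK: (x \in K); case yK: (y \in K).
- by apply: inj_in; rewrite ?mem_sk.
- by have := lt_out_in x y xK (negbT yK); rewrite eq_xy ltnn.
- by have := lt_out_in y x yK (negbT xK); rewrite eq_xy ltnn.
- by apply: inj_out; rewrite ?mem_sw ?xK ?yK.
Qed.
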